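(* Let $q_0,q_1,q_2,q_3$ be real polynomials in one variable such that $q_0(0)=0$, $q_0'(0)=1$, $q_1(0)=0$, and $q_3$ is not identically zero. The polynomial Abel system $$\dot x = -y, \qquad \dot y = q_0(x) + 3 q_1(x) y + q_2(x) y^2 + q_3(x) y^3$$ commutes with some transversal polynomial system if and only if it has the form $$\dot x = -y, \qquad \dot y = (x + a^2 x^3)(1 + h(x) y)^3 + 3 a x y\,(1 + h(x) y)^2 - h'(x) y^3$$ for some real number $a$ and some real polynomial $h(x)$.
   Context: Two planar vector fields $(p,q)$ and $(r,s)$ (equivalently, the systems $\dot x=p,\ \dot y=q$ and $\dot x=r,\ \dot y=s$) commute if their Lie bracket vanishes identically, i.e. $$r p_x + s p_y - p r_x - q r_y = 0, \qquad r q_x + s q_y - p s_x - q s_y = 0.$$ Two vector fields are transversal at a point if their values there are linearly independent. A polynomial system is called transversal to the given one if its field is transversal to the given field at every point of some punctured neighborhood of the origin. *)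

(* Defs.v *)
(* MathComp / MathComp-Analysis *)
From mathcomp Require Import all_boot all_order all_algebra.
From mathcomp Require Import all_classical all_reals all_analysis.

Set Implicit Arguments.
Unset Strict Implicit.
Unset Printing Implicit Defensive.

Import Order.TTheory GRing.Theory Num.Theory.
Import numFieldNormedType.Exports.

Local Open Scope classical_set_scope.
Local Open Scope ring_scope.

(* Polynomials in x and y follow the convention of polyXY: 'X (outer) is x,
   'Y := 'X%:P (inner) is y, p^:P is the polynomial p(x) seen in R[x, y], and
   u.[x, y] is evaluation. *)
Definition planar_field (R : nzRingType) : Type :=
  {poly {poly R}} * {poly {poly R}}.

Definition partialX (R : nzRingType) (u : {poly {poly R}}) : {poly {poly R}} :=
  u^`().

Definition partialY (R : nzRingType) (u : {poly {poly R}}) : {poly {poly R}} :=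
  map_poly (@deriv R) u.

Definition lie_bracket (R : nzRingType) (V W : planar_field R) :
    planar_field R :=
  let: (p, q) := V in let: (r, s) := W in
  (r * partialX p + s * partialY p - p * partialX r - q * partialY r,
   r * partialX q + s * partialY q - p * partialX s - q * partialY s).

Definition commuting (R : nzRingType) (V W : planar_field R) : Prop :=
  lie_bracket V W = (0, 0).

(* R^o * R^o carries the R-vector space structure needed by [free]. *)
Definition field_at (R : nzRingType) (V : planar_field R) (z : R * R) :
    R^o * R^o :=
  (V.1.[z.1, z.2], V.2.[z.1, z.2]).

Definition transversal_at (R : fieldType) (V W : planar_field R) (z : R * R) :
    Prop :=
  free [:: field_at V z; field_at W z].

Definition transversal_near_origin (R : realType) (V W : planar_field R) : Prop :=
  \forall z \near ((0, 0) : R * R)^', transversal_at V W z.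

Definition abel_system (R : nzRingType) (q0 q1 q2 q3 : {poly R}) :
    planar_field R :=
  (- 'Y,
   q0^:P + 3 * q1^:P * 'Y + q2^:P * 'Y ^+ 2 + q3^:P * 'Y ^+ 3).

Definition abel_normal_form (R : nzRingType) (a : R) (h : {poly R}) :
    planar_field R :=
  (- 'Y,
   ('X + a ^+ 2 *: 'X^3)^:P * (1 + h^:P * 'Y) ^+ 3
   + ((3 * a) *: 'X)^:P * 'Y * (1 + h^:P * 'Y) ^+ 2
   - (h^`())^:P * 'Y ^+ 3).

(* Main.v *)
(** Write [Q] for the second component of the Abel field and [D] for the
    derivation it induces on R[x, y].  The field commutes with [(r, s)] iff
    [s = - D r] and [D (D r) - Q_y * D r + Q_x * r = 0].  If [n] is the degree
    of [r] in [y], the top coefficient of the left-hand side is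
    [n * (n - 1) * q3 ^ 2 * r_n], so [r = b(x) + c(x) y].  Transversality then
    forces, up to a constant factor, [b = q0] and [c' = q1'], and two
    integrations give
      [q0' - 3 q1^2 + q0 q2 = 1],   [q0^2 q3 = q1 + q1^3 - q0 q1'].
    Put [f = gcd(q0, q1)] and [q0 = f g].  Then [g] divides [1 + q1^2], and
    [f g] divides [2 f' g - f g' - 2], which has smaller degree, so
    [2 f' g - f g' = 2].  Comparing degrees after replacing [g] by [g - k f^2]
    yields [deg f = 1], whence [q0 = x + K x^3]; finally [1 + K x^2] divides
    [1 + q1^2], which makes [K] a square [a^2] and [q1 = a x + q0 h].
    Conversely [r = q0 + q1 y] works: the determinant of the two fields is
    minus a positive definite form near the origin. *)
Require Import Defs.
From mathcomp Require Import all_boot all_order all_algebra.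
From mathcomp Require Import all_classical all_reals all_analysis.
From mathcomp Require Import ring lra zify.

Set Implicit Arguments.
Unset Strict Implicit.
Unset Printing Implicit Defensive.

Import Order.TTheory GRing.Theory Num.Theory.
Import numFieldNormedType.Exports.
Local Open Scope ring_scope.

(** * Top coefficients of products and Wronskians *)

Lemma coefM_top (R : nzRingType) (p q : {poly R}) (m n : nat) :
  (size p <= m.+1)%N -> (size q <= n.+1)%N -> (p * q)`_(m + n) = p`_m * q`_n.
Proof.
move=> sp sq; rewrite coefM.
have lt_m : (m < (m + n).+1)%N by rewrite ltnS leq_addr.
rewrite (bigD1 (Ordinal lt_m)) //= addKn big1 ?addr0 // => i.
rewrite -val_eqE neq_ltn /= => /orP[lt_i | gt_i].
  by rewrite [q`_ _]nth_default ?mulr0 // (leq_trans sq) //; move: lt_i; lia.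
by rewrite [p`_ _]nth_default ?mul0r // (leq_trans sp).
Qed.

Lemma coefXderiv (R : nzRingType) (p : {poly R}) (n : nat) :
  ('X * p^`())`_n = p`_n *+ n.
Proof. by rewrite coefXM coef_deriv; case: n => [|n]. Qed.

Lemma size_Xderiv (R : nzRingType) (p : {poly R}) (n : nat) :
  (size p <= n)%N -> (size ('X * p^`())%R <= n)%N.
Proof.
move=> /leq_sizeP sp; apply/leq_sizeP => j le_nj.
by rewrite coefXderiv sp ?mul0rn.
Qed.

Lemma coef_wronskian_top (R : comNzRingType) (k : R) (p q : {poly R}) (m n : nat) :
  (size p <= m.+1)%N -> (size q <= n.+1)%N ->
  ('X * (k%:P * (p^`() * q) - p * q^`()))`_(m + n)
  = (k * m%:R - n%:R) * (p`_m * q`_n).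
Proof.
move=> sp sq.
have -> : 'X * (k%:P * (p^`() * q) - p * q^`())
  = k%:P * (('X * p^`()) * q) - p * ('X * q^`()) by ring.
rewrite coefB coefCM !coefM_top ?size_Xderiv // !coefXderiv.
rewrite -[_ *+ m]mulr_natr -[_ *+ n]mulr_natr; ring.
Qed.

Section NumFieldPoly.
Variable R : numFieldType.
Implicit Types p q f g : {poly R}.

(** Let [u] be [q] minus the multiple of [p] that cancels the coefficient at the degree of [p]. Its
    Wronskian with [p] still vanishes, so if [u] were nonzero its degree would be that of [p], where
    its coefficient is zero. *)
Lemma wronskian_eq0_colinear p q :
  p != 0 -> p^`() * q = p * q^`() -> exists c : R, q = c *: p.
Proof.
move=> p0 w0.
pose c := q`_(size p).-1 / lead_coef p; exists c.
apply/eqP; rewrite -subr_eq0; apply: contraT => u0.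
set u := q - c *: p in u0.
have uw : p^`() * u - p * u^`() = 0.
  by rewrite /u derivB derivZ -!mul_polyC mulrBr w0; ring.
have um : u`_(size p).-1 = 0.
  by rewrite /u coefB coefZ /c -lead_coefE divfK ?subrr // lead_coef_eq0.
have sp : (size p <= (size p).-1.+1)%N by exact: leqSpred.
have su : (size u <= (size u).-1.+1)%N by exact: leqSpred.
have /eqP := coef_wronskian_top 1 sp su.
rewrite polyC1 !mul1r uw mulr0 coef0 eq_sym -!lead_coefE !mulf_eq0 !lead_coef_eq0.
rewrite (negPf p0) (negPf u0) !orbF subr_eq0 eqr_nat => /eqP e.
by move: um; rewrite e => /eqP; rewrite -lead_coefE lead_coef_eq0 (negPf u0).
Qed.

Lemma deriv_eq0_polyC p : p^`() = 0 -> p = (p`_0)%:P.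
Proof.
move=> dp; apply/polyP => -[|i]; rewrite coefC //=.
have /eqP := congr1 (fun q : {poly R} => q`_i) dp.
by rewrite coef_deriv coef0 mulrn_eq0 => /eqP.
Qed.

(* Subtracting a multiple of [f ^+ 2] from [g] preserves the equation and
   removes the only degree of [g] for which the top terms cancel. *)
Lemma weighted_wronskian_const f g :
  2%:P * (f^`() * g) - f * g^`() = 2%:P -> (1 < size f)%N ->
  size f = 2 /\ exists k u : R, g = u%:P + k%:P * f ^+ 2.
Proof.
move=> w2 sf.
have f0 : f != 0 by rewrite -size_poly_gt0; exact: ltn_trans sf.
set m := (size f).-1.
have sfm : size f = m.+1 by rewrite /m prednK // ltnW.
have fm0 : f`_m != 0 by rewrite /m -lead_coefE lead_coef_eq0.
have sfle : (size f <= m.+1)%N by rewrite sfm.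
pose k := g`_(m + m) / (f`_m) ^+ 2.
pose u := g - k%:P * f ^+ 2.
have gu : g = u + k%:P * f ^+ 2 by rewrite /u subrK.
have uw : 2%:P * (f^`() * u) - f * u^`() = 2%:P.
  by rewrite -[RHS]w2 /u derivB derivM derivC expr2 derivM; ring.
have u0 : u != 0.
  apply/eqP => u0; move/eqP: uw; rewrite u0 deriv0 !mulr0 subrr eq_sym polyC_eq0.
  by rewrite pnatr_eq0.
have um : u`_(m + m) = 0.
  rewrite /u coefB coefCM expr2 coefM_top // /k expr2 divfK ?subrr //.
  by rewrite mulf_neq0.
set n := (size u).-1.
have sun : size u = n.+1 by rewrite /n prednK // size_poly_gt0.
have un0 : u`_n != 0 by rewrite /n -lead_coefE lead_coef_eq0.
have sule : (size u <= n.+1)%N by rewrite sun.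
have := coef_wronskian_top 2 sfle sule.
rewrite uw coefXM coefC.
(* After multiplication by ['X] the right-hand side is [2 'X], so index 1 is the only one where the
   top coefficient may survive; everywhere else [n = 2 m] is forced, against [um]. *)
case: ((m + n)%N =P 1%N) => [mn1 _ | mn1].
  have m0 : (0 < m)%N by rewrite -ltnS -sfm.
  have [em en] : m = 1%N /\ n = 0%N by lia.
  split; first by rewrite sfm em.
  by exists k, u`_0; rewrite {1}gu; congr (_ + _); apply: size1_polyC; rewrite sun en.
have -> : (if (m + n)%N == 0%N then 0 else if (m + n).-1 == 0%N then 2 else 0) = 0 :> R.
  by case: (m + n)%N mn1 => [|[|]].
move/eqP; rewrite eq_sym !mulf_eq0 (negPf fm0) (negPf un0) !orbF subr_eq0 -natrM eqr_nat.
move=> /eqP e; have en : n = (m + m)%N by rewrite -e mul2n addnn.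
by move: un0; rewrite en um eqxx.
Qed.

End NumFieldPoly.

Lemma polyC2 (R : nzRingType) : 2%:P = 2 :> {poly R}.
Proof. exact: rmorph_nat. Qed.

Lemma size2_root0 (R : nzRingType) (f : {poly R}) :
  (size f <= 2)%N -> f.[0] = 0 -> f = (f`_1)%:P * 'X.
Proof.
rewrite horner_coef0 => /leq_sizeP sf f0; apply/polyP => -[|[|i]].
- by rewrite coefMX.
- by rewrite coefMX coefC.
- by rewrite sf // coefMX coefC.
Qed.

(** * Solving the two integrated equations for the coefficients *)

Section AbelCoefficients.
Variables (R : realFieldType) (q0 q1 q2 q3 : {poly R}).
Hypothesis q0_0 : q0.[0] = 0.
Hypothesis q1_0 : q1.[0] = 0.
Hypothesis dq0_0 : q0^`().[0] = 1.
Hypothesis q2E : q0^`() - 3 * q1 ^+ 2 + q0 * q2 = 1.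
Hypothesis q3E : q0 ^+ 2 * q3 = q1 + q1 ^+ 3 - q0 * q1^`().

Lemma abel_q0_neq0 : q0 != 0.
Proof. by apply: contra_eq_neq dq0_0 => ->; rewrite deriv0 horner0 eq_sym oner_eq0. Qed.

Lemma abel_q0_cubic :
  exists2 K : R, q0 = 'X + K%:P * 'X^3 & 1 + K%:P * 'X^2 %| 1 + q1 ^+ 2.
Proof.
have q0N0 := abel_q0_neq0.
pose f := gcdp q0 q1; pose g := q0 %/ f; pose k := q1 %/ f.
have q0fg : q0 = g * f by rewrite divpK // dvdp_gcdl.
have q1fk : q1 = k * f by rewrite divpK // dvdp_gcdr.
have f0 : f != 0 by rewrite gcdp_eq0 negb_and q0N0.
have g0 : g != 0 by apply: contraNneq q0N0 => g0; rewrite q0fg g0 mul0r.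
have cgk : coprimep g k by rewrite coprimep_div_gcd // q0N0.
have f_0 : f.[0] = 0.
  by apply/rootP; rewrite root_gcd; apply/andP; split; apply/rootP.
have sf : (1 < size f)%N by apply: (root_size_gt1 f0); apply/rootP/f_0.
clearbody f g k.
have [t tE] : exists t : {poly R}, 1 + q1 ^+ 2 = t * g.
  (* The equation [q3E] reads [q0 (q0 q3 + q1') = q1 (1 + q1^2)]; cancelling [f] leaves [g] times
     the witness on the left and [k (1 + q1^2)] on the right. *)
  apply/dvdpP; rewrite -(Gauss_dvdpr _ cgk); apply/dvdpP.
  exists (q0 * q3 + q1^`()); apply: (mulIf f0).
  have -> : k * (1 + q1 ^+ 2) * f = q1 + q1 ^+ 3 by rewrite [in RHS]q1fk [in LHS]q1fk; ring.
  transitivity (q0 ^+ 2 * q3 + q0 * q1^`()); first by rewrite q3E; ring.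
  by rewrite -[RHS]mulrA -q0fg; ring.
have dq0 : q0^`() = g^`() * f + g * f^`() by rewrite q0fg derivM.
have q0q2E : q0 * q2 = 1 - q0^`() + 3 * q1 ^+ 2 by rewrite -[X in X - q0^`()]q2E; ring.
have fE : 1 - g * f^`() = f * (g^`() - 3 * k * q1 + g * q2).
  by rewrite -[in LHS]q2E dq0 q0fg q1fk; ring.
(* Modulo [f], [fE] gives [g f' = 1], which also makes [f] and [g] coprime. Modulo [g], [q1^2 = -1]
   and [q0 q2 = 0] give [f g' = -2]. Hence [f g] divides the difference of the two sides, whose
   degree is smaller. *)
have w : 2%:P * (f^`() * g) - f * g^`() = 2%:P.
  rewrite polyC2; apply/eqP; rewrite -subr_eq0; apply: contraT => E0.
  have cfg : coprimep f g.
    apply/Bezout_eq1_coprimepP; exists (g^`() - 3 * k * q1 + g * q2, f^`()).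
    by rewrite /= -[RHS](subrK (g * f^`())) fE; ring.
  have : f * g %| 2 * (f^`() * g) - f * g^`() - 2.
    rewrite (Gauss_dvdp _ cfg); apply/andP; split; apply/dvdpP.
      exists (- 2 * (g^`() - 3 * k * q1 + g * q2) - g^`()).
      transitivity (- 2 * (f * (g^`() - 3 * k * q1 + g * q2)) - f * g^`()); last by ring.
      by rewrite -fE; ring.
    exists (3 * f^`() - 3 * t + f * q2).
    transitivity (3 * f^`() * g - 3 * (t * g) + q0 * q2); last by rewrite q0fg; ring.
    by rewrite -tE q0q2E dq0; ring.
  move/(dvdp_leq E0); rewrite leqNgt => /negP[].
  have sdf := lt_size_deriv f0; have sdg := lt_size_deriv g0.
  have sfg : size (f * g) = (size f + size g).-1 by rewrite size_mul.
  have sg : (0 < size g)%N by rewrite size_poly_gt0.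
  rewrite (leq_ltn_trans (size_polyD _ _)) // gtn_max size_polyN; apply/andP; split; last first.
    by rewrite -polyC2 (leq_ltn_trans (size_polyC_leq1 _)) // sfg; lia.
  rewrite (leq_ltn_trans (size_polyD _ _)) // gtn_max size_polyN; apply/andP; split.
    rewrite -polyC2 mul_polyC (leq_ltn_trans (size_scale_leq _ _)) //.
    rewrite (leq_ltn_trans (size_polyMleq _ _)) // sfg.
    by rewrite -ltnS !prednK ?ltn_add2r ?addn_gt0 ?sg ?orbT.
  rewrite (leq_ltn_trans (size_polyMleq _ _)) // sfg.
  by rewrite -ltnS !prednK ?ltn_add2l ?addn_gt0 ?sg ?orbT // ltnW.
have [sf2 [kap [u gE]]] := weighted_wronskian_const w sf.
have fX : f = (f`_1)%:P * 'X by apply: size2_root0; rewrite ?sf2.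
move: (f`_1) fX => c fX.
(* At the origin [f] vanishes, so [fE] becomes [f'(0) g(0) = 1], with [f'(0) = c] and [g(0) = u]. *)
have uc : c * u = 1.
  have := congr1 (horner^~ 0) fE; rewrite hornerM f_0 mul0r => /eqP.
  have -> : f^`() = c%:P by rewrite fX derivM derivX derivC mul0r add0r mulr1.
  rewrite hornerD hornerN hornerM !hornerC gE hornerD hornerC hornerM horner_exp f_0.
  by rewrite expr0n mulr0 addr0 subr_eq0 eq_sym mulrC => /eqP.
have ucP : c%:P * u%:P = 1 by rewrite -polyCM uc polyC1.
have q0E : q0 = 'X + (kap * c ^+ 3)%:P * 'X^3.
  rewrite q0fg gE fX; transitivity (c%:P * u%:P * 'X + (kap * c ^+ 3)%:P * 'X^3).
    by rewrite !polyCM ?polyC_exp; ring.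
  by rewrite ucP mul1r.
exists (kap * c ^+ 3) => //.
have gE' : g = u *: (1 + (kap * c ^+ 3)%:P * 'X^2).
  rewrite gE fX -mul_polyC mulrDr mulr1; congr (_ + _).
  transitivity ((c%:P * u%:P) * (kap * c ^+ 2)%:P * 'X^2).
    by rewrite ucP polyCM ?polyC_exp; ring.
  by rewrite !polyCM ?polyC_exp; ring.
rewrite -(dvdpZl (c := u)) -?gE'; first by apply/dvdpP; exists t.
by apply: contraTneq isT => u0; move/eqP: uc; rewrite u0 mulr0 eq_sym oner_eq0.
Qed.

(** For nonzero [K], reduce [q1] modulo [g = 1 + K x^2]. The remainder [w = v + a x] still satisfies
    [g %| 1 + w^2], and both have degree at most 2, so they are proportional; comparing coefficients
    yields [v = 0] and [K = a^2]. *)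
Lemma abel_q0q1 : exists a : R, exists h : {poly R},
  q0 = 'X + (a ^+ 2)%:P * 'X^3 /\ q1 = a%:P * 'X + q0 * h.
Proof.
have [K q0E dvd_g] := abel_q0_cubic.
have [l lE] : exists l : {poly R}, q1 = l * 'X.
  have /factor_theorem[l ->] : root q1 0 by apply/rootP.
  by exists l; rewrite subr0.
(* If [K = 0] then [q0 = x], and [q1(0) = 0] already gives the claim with [a = 0]. *)
have [K0 | K0] := eqVneq K 0.
  exists 0, l; rewrite q0E K0 expr0n /= polyC0 !mul0r addr0 add0r.
  by split => //; rewrite lE mulrC.
set g := 1 + K%:P * 'X^2 in dvd_g.
have g_0 : g.[0] = 1 by rewrite /g hornerD hornerM horner_exp hornerX expr0n mulr0 addr0 hornerC.
have g_coef i : g`_i = (i == 0%N)%:R + K * (i == 2)%:R.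
  by rewrite /g coefD coefCM coefXn coef1.
have sg : size g = 3.
  apply/eqP; rewrite eqn_leq; apply/andP; split.
    by apply/leq_sizeP => -[|[|[|j]]] //; rewrite g_coef /= mulr0 addr0.
  rewrite ltnNge; apply: contra K0 => /leq_sizeP/(_ 2 (leqnn 2)).
  by rewrite g_coef /= add0r mulr1 => ->.
have g0 : g != 0 by rewrite -size_poly_gt0 sg.
pose w := q1 %% g.
have sw : (size w <= 2)%N by have := ltn_modp q1 g; rewrite g0 sg.
have q1E : q1 = (q1 %/ g) * g + w := divp_eq q1 g.
set k := q1 %/ g in q1E; clearbody k w.
have wE : w = (w`_0)%:P + (w`_1)%:P * 'X.
  apply/polyP => -[|[|i]]; rewrite coefD coefC coefCM coefX /=.
  - by rewrite mulr0 addr0.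
  - by rewrite mulr1 add0r.
  - by rewrite mulr0 addr0 nth_default // (leq_trans sw).
move: (w`_0) (w`_1) wE => v a wE.
have [t tE] : exists t : {poly R}, 1 + w ^+ 2 = t * g.
  apply/dvdpP; have -> : 1 + w ^+ 2 = 1 + q1 ^+ 2 - g * (k * (q1 + w)).
    by rewrite {1 2}q1E; ring.
  by rewrite dvdp_sub // dvdp_mulr.
have sq_coef : 1 + w ^+ 2 = (1 + v ^+ 2)%:P + (2 * v * a)%:P * 'X + (a ^+ 2)%:P * 'X^2.
  by rewrite wE polyCD !polyCM !polyC1 polyC2; ring.
(* Here the order on [R] enters: the constant coefficient [1 + v^2] is positive. *)
have t0 : t != 0.
  apply: contraTneq (ltr01 : 0 < 1 :> R) => t0; rewrite -leNgt.
  have := congr1 (fun p : {poly R} => p`_0) sq_coef.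
  rewrite /= tE t0 mul0r coef0 !coefD coefC !coefCM coefX coefXn !mulr0 !addr0 /=.
  by move: (sqr_ge0 v); lra.
have st : size t = 1%N.
  have : (size (t * g)%R <= 3)%N.
    rewrite -tE sq_coef; apply/leq_sizeP => -[|[|[|j]]] // _.
    by rewrite !coefD coefC !coefCM coefX coefXn /= !mulr0 !addr0.
  rewrite size_mul // sg; move: t0; rewrite -size_poly_gt0.
  by case: (size t) => [|[|n]] //; rewrite addn3.
have tC : t = (t`_0)%:P by apply: size1_polyC; rewrite st.
move: (t`_0) tC => c tC.
have coefs i : (1 + w ^+ 2)`_i = c * g`_i by rewrite tE tC coefCM.
move: (coefs 0%N) (coefs 1%N) (coefs 2%N).
rewrite !g_coef sq_coef !coefD !coefC !coefCM !coefX !coefXn /=.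
rewrite !mulr0 !mulr1 !addr0 !add0r !mulr0 ?addr0 ?mulr1 => c_eq /eqP va aa.
(* The three coefficients give [1 + v^2 = c], [2 v a = 0] and [a^2 = c K]. As [c K] is nonzero, so
   is [a]; hence [v = 0] and [c = 1]. *)
have c0 : c != 0 by apply: contraNneq t0 => c0; rewrite tC c0.
have a0 : a != 0 by rewrite -sqrf_eq0 aa mulf_neq0.
have v0 : v = 0.
  by move: va; rewrite -mulrA !mulf_eq0 pnatr_eq0 (negPf a0) orbF => /eqP.
have Ka : K = a ^+ 2 by rewrite aa -c_eq v0 expr0n /= addr0 mul1r.
(* Since [q1] and [w] vanish at 0 while [g] is 1 there, the quotient [k] vanishes at 0; its factor
   ['X] completes [g] to [q0]. *)
have [h hE] : exists h : {poly R}, k = h * 'X.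
  have /factor_theorem[h ->] : root k 0.
    apply/rootP; move: q1_0; rewrite q1E wE v0 !hornerD !hornerM g_0 hornerX.
    by rewrite hornerC !mulr0 mulr1 !addr0.
  by exists h; rewrite subr0.
exists a, h; rewrite -Ka; split => //.
by rewrite [LHS]q1E wE v0 hE q0E /g polyC0; ring.
Qed.

(** Once [q0] and [q1] are known, the two equations determine [q2] and [q3] by cancelling [q0] and
    [q0 ^+ 2]. *)
Lemma abel_coefficients : exists a : R, exists h : {poly R},
  [/\ q0 = 'X + (a ^+ 2)%:P * 'X^3,
      q1 = a%:P * 'X + q0 * h,
      q2 = 3 * q0 * h ^+ 2 + 6 * a%:P * 'X * h &
      q3 = q0 * h ^+ 3 + 3 * a%:P * 'X * h ^+ 2 - h^`()].
Proof.
have q0N0 := abel_q0_neq0.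
have [a [h [q0E q1E]]] := abel_q0q1.
have dq0 : q0^`() = 1 + 3 * (a ^+ 2)%:P * 'X^2.
  by rewrite q0E derivD derivX derivM derivC derivXn; ring.
have dq1 : q1^`() = a%:P + q0^`() * h + q0 * h^`().
  by rewrite q1E derivD !derivM derivX derivC; ring.
have aP : (a ^+ 2)%:P = a%:P ^+ 2 by rewrite polyC_exp.
exists a, h; split => //.
  apply: (mulfI q0N0); transitivity (1 - q0^`() + 3 * q1 ^+ 2).
    by rewrite -[X in X - q0^`()]q2E; ring.
  by rewrite dq0 q1E aP; ring.
apply: (mulfI (expf_neq0 2 q0N0)); rewrite q3E dq1 dq0 q1E aP.
(* [q0] stays a variable for [ring]; the only use of its explicit form is collected in the first
   term, which is zero. *)
transitivity (a%:P * ('X + a%:P ^+ 2 * 'X^3 - q0) + q0 ^+ 2 *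
   (q0 * h ^+ 3 + 3 * a%:P * 'X * h ^+ 2 - h^`())); first by ring.
by rewrite -aP -q0E subrr mulr0 add0r.
Qed.

End AbelCoefficients.

(** * Partial derivatives in [R[x, y]] *)

Section PartialDerivatives.
Variable R : comNzRingType.
Implicit Types (p : {poly R}) (u v : {poly {poly R}}).

(** Exchanging the variables makes [y] the outer one, so rules for [partialY] and degrees in [y]
    reduce to those of ordinary univariate polynomials. *)
Lemma swapXY_partialY u : swapXY (partialY u) = (swapXY u)^`().
Proof.
apply/polyP => i; apply/polyP => j.
by rewrite coef_swapXY coef_map !coef_deriv coefMn coef_swapXY.
Qed.

Lemma swapXY_partialX u : swapXY (partialX u) = map_poly (@deriv R) (swapXY u).
Proof.
apply/polyP => i; apply/polyP => j.
by rewrite coef_swapXY coef_map !coef_deriv coefMn coef_swapXY.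
Qed.

Lemma partialYE u : partialY u = swapXY ((swapXY u)^`()).
Proof. by rewrite -swapXY_partialY swapXYK. Qed.

Lemma partialXD u v : partialX (u + v) = partialX u + partialX v.
Proof. exact: derivD. Qed.

Lemma partialXN u : partialX (- u) = - partialX u.
Proof. exact: derivN. Qed.

Lemma partialXM u v : partialX (u * v) = partialX u * v + u * partialX v.
Proof. exact: derivM. Qed.

Lemma partialXY : partialX ('Y : {poly {poly R}}) = 0.
Proof. exact: derivC. Qed.

Lemma partialXP p : partialX p^:P = (p^`())^:P.
Proof. exact: deriv_map. Qed.

Lemma partialYD u v : partialY (u + v) = partialY u + partialY v.
Proof. exact: raddfD. Qed.

Lemma partialYN u : partialY (- u) = - partialY u.
Proof. exact: raddfN. Qed.

Lemma partialYM u v : partialY (u * v) = partialY u * v + u * partialY v.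
Proof.
apply: (can_inj (@swapXYK R)); rewrite swapXY_partialY.
by rewrite [swapXY (u * v)]rmorphM derivM [RHS]rmorphD !rmorphM /= !swapXY_partialY.
Qed.

Lemma partialYY : partialY ('Y : {poly {poly R}}) = 1.
Proof. by rewrite partialYE swapXY_Y derivX rmorph1. Qed.

Lemma partialYP p : partialY p^:P = 0.
Proof. by rewrite partialYE swapXY_map_polyC derivC rmorph0. Qed.

Lemma partialX1 : partialX (1 : {poly {poly R}}) = 0.
Proof. exact: derivC. Qed.

Lemma partialY1 : partialY (1 : {poly {poly R}}) = 0.
Proof. by rewrite partialYE rmorph1 -polyC1 derivC rmorph0. Qed.

Definition partialE := (partialXD, partialXN, partialXM, partialXY, partialXP,
  partialYD, partialYN, partialYM, partialYY, partialYP, partialX1, partialY1).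

End PartialDerivatives.

(** * Commutation as a second-order equation, and its degree in [y] *)

Definition lie_derivative (R : nzRingType) (V : planar_field R)
    (u : {poly {poly R}}) : {poly {poly R}} :=
  V.1 * partialX u + V.2 * partialY u.

Definition abel_commutant (R : nzRingType) (V : planar_field R)
    (r : {poly {poly R}}) : {poly {poly R}} :=
  lie_derivative V (lie_derivative V r)
  - partialY V.2 * lie_derivative V r + partialX V.2 * r.

(** With first component [-y], the first bracket equation is [- s - D r = 0]; eliminating [s] turns
    the second into [abel_commutant]. *)
Lemma commuting_YP (R : comNzRingType) (Q r s : {poly {poly R}}) :
  commuting (- 'Y, Q) (r, s) <->
  s = - lie_derivative (- 'Y, Q) r /\ abel_commutant (- 'Y, Q) r = 0.
Proof.
rewrite /commuting /lie_bracket /abel_commutant /lie_derivative /= !partialE oppr0.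
split=> [[e1 e2] | [-> e2]].
  have sE : s = - (- 'Y * partialX r + Q * partialY r).
    apply/eqP; rewrite -subr_eq0 -oppr_eq0; apply/eqP.
    by rewrite -[RHS]e1; ring.
  by split => //; rewrite -[RHS]e2 sE !partialE; ring.
congr (_, _); first by ring.
by rewrite -[RHS]e2 !partialE; ring.
Qed.

Section AbelCommutant.
Variables (R : numFieldType) (q0 q1 q2 q3 : {poly R}).
Implicit Types (u : {poly {poly R}}) (b c : {poly R}).

Local Notation V := (abel_system q0 q1 q2 q3).

(** No power of [y] above the third survives: [c Q Q_y] and [c y Q_x] each occur with both signs,
    and so does [3 c' q3 y^4]. *)
Lemma abel_commutant_linear b c :
  abel_commutant V (b^:P + c^:P * 'Y) =
    (b * q0^`() - q0 * b^`())^:P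
    + (3 * (b * q1^`() - c^`() * q0))^:P * 'Y
    + (b^`()^`() - 6 * c^`() * q1 + q2 * b^`() + b * q2^`())^:P * 'Y ^+ 2
    + (c^`()^`() - c^`() * q2 + 2 * b^`() * q3 + b * q3^`())^:P * 'Y ^+ 3.
Proof.
rewrite /abel_commutant /lie_derivative /abel_system /=.
set Q := _ + q3^:P * _.
have QY : partialY Q = 3 * q1^:P + 2 * q2^:P * 'Y + 3 * q3^:P * 'Y ^+ 2.
  rewrite /Q !expr2 !exprS expr0 !mulr1 !partialE; ring.
have QX : partialX Q =
  (q0^`())^:P + 3 * (q1^`())^:P * 'Y + (q2^`())^:P * 'Y ^+ 2 + (q3^`())^:P * 'Y ^+ 3.
  rewrite /Q !expr2 !exprS expr0 !mulr1 !partialE; ring.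
have -> : partialY (b^:P + c^:P * 'Y) = c^:P by rewrite !partialE; ring.
have -> : partialX (b^:P + c^:P * 'Y) = (b^`())^:P + (c^`())^:P * 'Y.
  by rewrite !partialE; ring.
have -> : partialY (- 'Y * ((b^`())^:P + (c^`())^:P * 'Y) + Q * c^:P)
  = - (b^`())^:P - 2 * (c^`())^:P * 'Y + c^:P * partialY Q.
  by rewrite !partialE; ring.
have -> : partialX (- 'Y * ((b^`())^:P + (c^`())^:P * 'Y) + Q * c^:P)
  = - 'Y * ((b^`()^`())^:P + (c^`()^`())^:P * 'Y) + partialX Q * c^:P + Q * (c^`())^:P.
  by rewrite !partialE; ring.
by rewrite QX QY /Q; ring.
Qed.

Lemma size_abel_swap :
  (size (swapXY V.2) <= 4)%N.
Proof.
apply/leq_sizeP => i i4; rewrite /abel_system /= !rmorphD !(rmorphXn, rmorphM) /= rmorph_nat.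
rewrite !swapXY_map_polyC swapXY_Y -mulrA -polyC_natr !coefD !coefCM coefC coefX !coefXn.
by case: i i4 => [|[|[|[|i]]]] //= _; rewrite !mulr0 !addr0.
Qed.

Lemma coef3_abel_swap : (swapXY V.2)`_3 = q3.
Proof.
rewrite /abel_system /= !rmorphD !(rmorphXn, rmorphM) /= rmorph_nat.
rewrite !swapXY_map_polyC swapXY_Y -mulrA -polyC_natr !coefD !coefCM coefC coefX !coefXn.
by rewrite /= !mulr0 !add0r mulr1.
Qed.

Lemma swap_lie_derivative u :
  'X * swapXY (lie_derivative V u) =
  - 'X^2 * map_poly (@deriv R) (swapXY u) + swapXY V.2 * ('X * (swapXY u)^`()).
Proof.
rewrite /lie_derivative [swapXY (_ + _)]rmorphD /= 2![swapXY (_ * _)]rmorphM /=.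
rewrite [swapXY (- 'Y)](raddfN swapXY) /= swapXY_Y.
by rewrite swapXY_partialX swapXY_partialY; ring.
Qed.

Lemma size_map_deriv (v : {poly {poly R}}) n :
  (size v <= n -> size (map_poly (@deriv R) v) <= n)%N.
Proof. by apply: leq_trans; exact: size_poly. Qed.

(** Only [q3 y^3] times the derivative in [y] raises the [y]-degree by two; the term [- y] times the
    derivative in [x] raises it by at most one. *)
Lemma lie_derivative_top u n : (size (swapXY u) <= n.+1)%N ->
  (size (swapXY (lie_derivative V u)) <= n.+3)%N
  /\ (swapXY (lie_derivative V u))`_n.+2 = q3 * (swapXY u)`_n *+ n.
Proof.
move=> su; have sdu := size_map_deriv su.
have coefS i : (swapXY (lie_derivative V u))`_i =
    ('X * swapXY (lie_derivative V u))`_i.+1 by rewrite coefXM.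
have sXu := size_Xderiv su; have sQ := size_abel_swap.
split.
  apply/leq_sizeP => i ni; rewrite coefS swap_lie_derivative.
  rewrite coefD mulNr coefN coefXnM [X in if X then _ else _]ltnNge ltnS (leq_trans _ ni) //=.
  rewrite [_`_(i.+1 - 2)]nth_default; last by rewrite (leq_trans sdu); lia.
  rewrite oppr0 add0r nth_default // (leq_trans (size_polyMleq _ _)) //.
  move: sQ sXu; move: (size (swapXY V.2)) (size ('X * _)) => a b; lia.
rewrite coefS swap_lie_derivative coefD mulNr coefN coefXnM /=.
rewrite [_`_(n.+3 - 2)]nth_default; last by rewrite (leq_trans sdu); lia.
rewrite oppr0 add0r -[n.+3]/(3 + n)%N coefM_top //.
by rewrite coef3_abel_swap coefXderiv mulrnAr.
Qed.

Lemma abel_commutant_degree u : q3 != 0 -> abel_commutant V u = 0 ->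
  exists b c : {poly R}, u = b^:P + c^:P * 'Y.
Proof.
move=> q30 u0.
have [su | su] := leqP (size (swapXY u)) 2.
  exists (swapXY u)`_0, (swapXY u)`_1; apply: (can_inj (@swapXYK R)).
  rewrite rmorphD rmorphM /= !swapXY_map_polyC swapXY_Y.
  apply/polyP => -[|[|i]]; rewrite coefD coefC coefCM coefX /=.
  - by rewrite mulr0 addr0.
  - by rewrite mulr1 add0r.
  - by rewrite mulr0 addr0 nth_default // (leq_trans su).
set n := (size (swapXY u)).-1.
have sun : size (swapXY u) = n.+1 by rewrite /n prednK // (ltn_trans _ su).
have n2 : (1 < n)%N by rewrite -ltnS -sun.
have un0 : (swapXY u)`_n != 0 by rewrite /n -lead_coefE lead_coef_eq0 -size_poly_gt0 sun.
have su1 : (size (swapXY u) <= n.+1)%N by rewrite sun.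
have [sDu Du] := lie_derivative_top su1.
have [sDDu DDu] := lie_derivative_top sDu.
(* This is the coefficient of [y^(n+4)], shifted by the auxiliary ['X]. The term [Q_x r] has
   [y]-degree at most [n + 3] and drops out. *)
have := congr1 (fun v => ('X * swapXY v)`_n.+4.+1) u0.
rewrite /abel_commutant rmorphD rmorphB !rmorphM /= swapXY_partialY swapXY_partialX.
rewrite rmorph0 mulr0 coef0 mulrDr mulrBr coefD coefB mulrA.
rewrite -[X in _ - X]/((_ * _ : {poly _})`_(3 + n.+2)%N) coefM_top ?size_Xderiv ?size_abel_swap //.
rewrite coefXderiv coef3_abel_swap Du !coefXM /= DDu Du.
rewrite [X in _ + X]nth_default; last first.
  rewrite (leq_trans (size_polyMleq _ _)) //.
  have := size_map_deriv size_abel_swap; rewrite sun.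
  by move: (size (map_poly _ _)) => a; lia.
rewrite addr0 => /eqP.
(* The arithmetic is [n (n + 2) - 3 n = n (n - 1)]. *)
have -> : q3 * (q3 * (swapXY u)`_n *+ n) *+ n.+2 - q3 *+ 3 * (q3 * (swapXY u)`_n *+ n)
  = (q3 ^+ 2 * (swapXY u)`_n) *+ (n * n.-1).
  move: (swapXY u)`_n (ltnW n2) => x; case: (n) => // k _ /=.
  rewrite -[q3 * x *+ _]mulr_natr -[_ *+ k.+3]mulr_natr -[q3 *+ 3]mulr_natr.
  by rewrite -[RHS]mulr_natr; ring.
rewrite -[_ *+ (n * _)]mulr_natr -polyC_natr !mulf_eq0 (negPf q30) (negPf un0) /=.
rewrite polyC_eq0 pnatr_eq0 muln_eq0.
by move: n2; case: (n) => [|[]].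
Qed.

Lemma cubicY_eq0 (c0 c1 c2 c3 : {poly R}) :
  c0^:P + c1^:P * 'Y + c2^:P * 'Y ^+ 2 + c3^:P * 'Y ^+ 3 = 0 ->
  [/\ c0 = 0, c1 = 0, c2 = 0 & c3 = 0].
Proof.
move/(congr1 swapXY); rewrite !rmorphD !(rmorphXn, rmorphM) /= !swapXY_map_polyC swapXY_Y rmorph0.
move=> e; have coefs i := congr1 (fun v : {poly {poly R}} => v`_i) e.
move: (coefs 0%N) (coefs 1%N) (coefs 2%N) (coefs 3%N).
by rewrite !coefD !coefCM !coefC !coefX !coefXn ?coef0 /= !mulr0 !mulr1 !addr0 !add0r.
Qed.

End AbelCommutant.

(** * Linear independence and neighborhoods of the origin *)

Lemma free2_det (F : fieldType) (v w : F^o * F^o) :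
  (v.1 * w.2 - v.2 * w.1 : F) != 0 -> free [:: v; w].
Proof.
move=> det0; rewrite free_cons span_seq1 -[free _]/(free [:: w]) free_cons.
rewrite span_nil memv0 nil_free andbT.
apply/andP; split.
  apply: contra det0 => /vlineP[k ->] /=; apply/eqP.
  by rewrite -[k *: w.1]/(k * w.1) -[k *: w.2]/(k * w.2); ring.
by apply: contraNneq det0 => -> /=; rewrite !mulr0 subrr.
Qed.

Lemma free2_colinear (F : fieldType) (k : F) (v : F^o * F^o) :
  free [:: v; k *: v] = false.
Proof.
rewrite free_cons span_seq1; case: (eqVneq k 0) => [-> | k0].
  by rewrite scale0r free_cons span_nil mem0v andbF.
apply/negbTE; rewrite negb_and negbK; apply/orP; left; apply/vlineP.
by exists k^-1; rewrite scalerA mulVf // scale1r.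
Qed.

Lemma hornerXY_map_polyC (R : comNzRingType) (p : {poly R}) (x y : R) :
  (p^:P).[x, y] = p.[x].
Proof. by rewrite horner_map hornerC. Qed.

Lemma hornerXY_Y (R : comNzRingType) (x y : R) : ('Y : {poly {poly R}}).[x, y] = y.
Proof. by rewrite hornerC hornerX. Qed.

Section Transversality.
Variable R : realType.

Lemma near_punctured_origin (P : R * R -> Prop) :
  (\forall z \near ((0, 0) : R * R)^'%classic, P z) -> exists z, P z.
Proof.
rewrite near_withinE => /nbhs_ballP[e /= e0 Pe].
exists (e / 2, 0); apply: Pe; last first.
  by rewrite xpair_eqE eqxx andbT; apply: lt0r_neq0; rewrite divr_gt0.
split => /=; last exact: ballxx.
by rewrite /ball /= sub0r normrN ger0_norm ?divr_ge0 ?(ltW e0) // ltr_pdivrMr // ltr_pMr // ltr1n.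
Qed.

(** This bound makes the coefficient of [y^2] positive in the quadratic form of the transversality
    argument. *)
Lemma near_origin_horner_mul (c : {poly R}) :
  \forall z \near ((0, 0) : R * R), `|c.[z.1] * z.2| < 1.
Proof.
have cv : (c.[z.1] * z.2 @[z --> ((0, 0) : R * R)] --> (0 : R))%classic.
  rewrite -[X in (_ --> X)%classic](mulr0 c.[0]).
  apply: cvgM; last exact: (@cvg_snd _ _ (nbhs (0 : R)) (nbhs (0 : R))).
  apply: (cvg_comp _ _ (@cvg_fst _ _ (nbhs (0 : R)) (nbhs (0 : R)) _)).
  exact: continuous_horner.
by move/cvgr0Pnorm_lt : cv; apply; exact: ltr01.
Qed.

End Transversality.

(** * Necessity: from a commuting transversal field to the integrated equations *)

Section AbelSystem.
Variables (R : realType) (q0 q1 q2 q3 : {poly R}).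

Local Notation V := (abel_system q0 q1 q2 q3).

Lemma abel_commuting_necessary (W : planar_field R) :
  q0.[0] = 0 -> q0^`().[0] = 1 -> q1.[0] = 0 -> q3 <> 0 ->
  commuting V W -> transversal_near_origin V W ->
  q0^`() - 3 * q1 ^+ 2 + q0 * q2 = 1
  /\ q0 ^+ 2 * q3 = q1 + q1 ^+ 3 - q0 * q1^`().
Proof.
move=> q0_0 dq0_0 q1_0 /eqP q3N0; have q0N0 := abel_q0_neq0 dq0_0.
case: W => r s /commuting_YP[sE r0] tr.
have [b [c rE]] := abel_commutant_degree q3N0 r0.
move: r0; rewrite rE abel_commutant_linear => /cubicY_eq0[/eqP e0 /eqP e1 e2 e3].
have [k bE] : exists k : R, b = k *: q0.
  apply: wronskian_eq0_colinear => //.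
  by move: e0; rewrite subr_eq0 => /eqP <-; rewrite mulrC.
rewrite -polyC_natr mulf_eq0 polyC_eq0 pnatr_eq0 /= subr_eq0 in e1; move/eqP: e1 => e1.
(* If [k = 0] then [b = 0] and [c] is a constant [c_0], so [r = c_0 y] and [s = - c_0 Q]: the second
   field is [- c_0] times the first, which contradicts transversality at any point. *)
have kN0 : k != 0.
  apply/eqP => k0; have b0 : b = 0 by rewrite bE k0 scale0r.
  have c0 : c^`() = 0.
    by apply/eqP; have /eqP := e1; rewrite b0 mul0r eq_sym mulf_eq0 (negPf q0N0) orbF.
  have [z] := near_punctured_origin tr; rewrite /transversal_at.
  have -> : field_at (r, s) z = (- c`_0) *: field_at V z; last by rewrite free2_colinear.
  have rY : r = (c`_0)%:P^:P * 'Y.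
    by rewrite rE b0 rmorph0 add0r; congr (_^:P * _); exact: deriv_eq0_polyC.
  have sY : s = - (V.2 * (c`_0)%:P^:P).
    by rewrite sE rY /lie_derivative !partialE derivC rmorph0; ring.
  have VE : field_at V z = (- z.2, V.2.[z.1, z.2]).
    by rewrite /field_at /= !hornerN hornerXY_Y.
  rewrite VE /field_at [(r, s).1]/= [(r, s).2]/= rY sY; congr (_, _) => /=.
    by rewrite !hornerM hornerXY_map_polyC hornerC hornerXY_Y scalerN scaleNr opprK.
  by rewrite !hornerN !hornerM hornerXY_map_polyC hornerC scaleNr mulrC.
have kP : k%:P != 0 by rewrite polyC_eq0.
have dc : c^`() = k%:P * q1^`().
  by apply: (mulIf q0N0); rewrite -e1 bE -mul_polyC; ring.
move: e2 e3; rewrite dc bE !mul_polyC !derivZ -!mul_polyC => e2 e3.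
have {}e2 : q0^`()^`() - 6 * q1^`() * q1 + q2 * q0^`() + q0 * q2^`() = 0.
  by apply: (mulfI kP); rewrite mulr0 -[RHS]e2; ring.
have {}e3 : q1^`()^`() - q1^`() * q2 + 2 * q0^`() * q3 + q0 * q3^`() = 0.
  by apply: (mulfI kP); rewrite mulr0 -[RHS]e3; ring.
have q2E : q0^`() - 3 * q1 ^+ 2 + q0 * q2 = 1.
  (* [e2] says exactly that [A] has zero derivative, and its value at 0 is [q0'(0) = 1]. *)
  set A := LHS; have /deriv_eq0_polyC -> : A^`() = 0.
    by rewrite -[RHS]e2 /A -polyC_natr !poly.derivE !polyC_natr; ring.
  rewrite -horner_coef0 /A -polyC_natr !hornerE q0_0 q1_0 dq0_0 -polyC1.
  by congr (_%:P) => /=; rewrite !mulr0 mul0r subr0 addr0.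
split; first exact: q2E.
apply/eqP; rewrite -subr_eq0; apply/eqP.
(* The derivative of [B] combines [e3] and the equation just integrated, with multipliers [q0] and
   [q1']. *)
set B := LHS; have /deriv_eq0_polyC -> : B^`() = 0.
  transitivity (q0 * (q1^`()^`() - q1^`() * q2 + 2 * q0^`() * q3 + q0 * q3^`())
      + q1^`() * (q0^`() - 3 * q1 ^+ 2 + q0 * q2 - 1)).
    by rewrite /B !poly.derivCE /=; ring.
  by rewrite e3 q2E subrr !mulr0 addr0.
rewrite -horner_coef0 /B !hornerE q0_0 q1_0.
by rewrite -polyC0; congr (_%:P) => /=; ring.
Qed.

End AbelSystem.

(** * Sufficiency: the normal form and its commuting field *)

Definition normal_q0 (R : nzRingType) (a : R) : {poly R} :=
  'X + (a ^+ 2)%:P * 'X^3.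

(** This is a third of the coefficient of [y] in the normal form, since the Abel system carries
    [3 q1 y]. *)
Definition normal_q1 (R : nzRingType) (a : R) (h : {poly R}) : {poly R} :=
  a%:P * 'X + normal_q0 a * h.

Definition normal_q2 (R : nzRingType) (a : R) (h : {poly R}) : {poly R} :=
  3 * normal_q0 a * h ^+ 2 + 6 * a%:P * 'X * h.

Definition normal_q3 (R : nzRingType) (a : R) (h : {poly R}) : {poly R} :=
  normal_q0 a * h ^+ 3 + 3 * a%:P * 'X * h ^+ 2 - h^`().

Lemma abel_normal_formE (R : comNzRingType) (a : R) (h : {poly R}) :
  abel_normal_form a h =
  abel_system (normal_q0 a) (normal_q1 a h) (normal_q2 a h) (normal_q3 a h).
Proof.
rewrite /abel_normal_form /abel_system; congr (_, _).
rewrite /normal_q3 /normal_q2 /normal_q1 -[_ + _ *: 'X^3]/('X + _) -!mul_polyC.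
rewrite -/(normal_q0 a); move: (normal_q0 a) => q0.
rewrite polyCM -[(3 : R)%:P]/(3%:R%:P) polyC_natr.
by ring.
Qed.

Lemma hornerXY_abel (R : comNzRingType) (q0 q1 q2 q3 : {poly R}) (x y : R) :
  (abel_system q0 q1 q2 q3).2.[x, y] =
  q0.[x] + 3 * q1.[x] * y + q2.[x] * y ^+ 2 + q3.[x] * y ^+ 3.
Proof.
rewrite /abel_system /= -!polyC_natr !(hornerD, hornerM, horner_exp).
by rewrite !hornerXY_map_polyC !hornerXY_Y !hornerC.
Qed.

(** In the determinant the terms [q1 y Q] cancel, leaving [- (q0 Q + y^2 (q0' + q1' y))].
    Substituting [q0'] removes [q2], and completing the square gives [dE]. Its bracket vanishes near
    the origin only if [y = 0] and [q0(x) = 0]. *)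
Lemma abel_transversal (R : realType) (q0 q1 q2 q3 : {poly R})
    (V := abel_system q0 q1 q2 q3) (r := q0^:P + q1^:P * 'Y) :
  q0^`() + q0 * q2 = 1 + 3 * q1 ^+ 2 -> (forall x, root q0 x -> x = 0) ->
  transversal_near_origin V (r, - lie_derivative V r).
Proof.
move=> q2E root_q0; rewrite /transversal_near_origin near_withinE.
have := near_origin_horner_mul (q1^`() + q0 * q3).
apply: filterS => -[x y] /= c_lt1 xy0.
have Dr : lie_derivative V r =
    - 'Y * ((q0^`())^:P + (q1^`())^:P * 'Y) + V.2 * q1^:P.
  rewrite /lie_derivative; have -> : partialX r = (q0^`())^:P + (q1^`())^:P * 'Y.
    by rewrite !partialE; ring.
  by have -> : partialY r = q1^:P by rewrite !partialE; ring.
have dq0x : q0^`().[x] = 1 + 3 * q1.[x] ^+ 2 - q0.[x] * q2.[x].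
  have := congr1 (horner^~ x) q2E.
  rewrite /= -polyC_natr !(hornerD, hornerM, hornerC, horner_exp) => <-.
  by rewrite addrK.
have Vxy : field_at V (x, y) = (- y, V.2.[x, y]).
  by rewrite /field_at /= !hornerN hornerXY_Y.
have Wxy : field_at (r, - lie_derivative V r) (x, y) =
    (q0.[x] + q1.[x] * y, y * (q0^`().[x] + q1^`().[x] * y) - V.2.[x, y] * q1.[x]).
  rewrite /field_at [(r, _).1]/= [(r, _).2]/= Dr; move: (V.2) => Q.
  rewrite !(hornerD, hornerM, hornerN) !hornerXY_map_polyC hornerXY_Y.
  by rewrite opprD mulNr opprK.
apply: free2_det; rewrite Vxy Wxy hornerXY_abel dq0x /=.
have q0x0 : q0.[x] = 0 -> x = 0 by move/rootP/root_q0.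
move: c_lt1 q0x0; rewrite !(hornerD, hornerM).
move: q0.[x] q1.[x] q1^`().[x] q2.[x] q3.[x] => A0 A1 B1 A2 A3 c_lt1 A0_0.
set d := (X in X != 0).
have dE : d = - ((A0 + 3 / 2 * A1 * y) ^+ 2
    + y ^+ 2 * (1 + (B1 + A0 * A3) * y + 3 / 4 * A1 ^+ 2)) by rewrite /d; field.
have M0 : 0 < 1 + (B1 + A0 * A3) * y + 3 / 4 * A1 ^+ 2.
  have := sqr_ge0 A1; move: (A1 ^+ 2) => S.
  by move: c_lt1; rewrite ltr_norml => /andP[]; move: (_ * y) => t; lra.
have yM0 := mulr_ge0 (sqr_ge0 y) (ltW M0).
rewrite dE oppr_eq0 paddr_eq0 ?sqr_ge0 //.
rewrite [y ^+ 2 * _ == 0]mulf_eq0 !sqrf_eq0 (gt_eqF M0) orbF.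
apply: contraNN xy0 => /andP[Ay /eqP y0].
by move: Ay; rewrite y0 mulr0 addr0 => /eqP/A0_0 ->.
Qed.

Section NormalForm.
Variables (R : realType) (a : R) (h : {poly R}).

Local Notation q0 := (normal_q0 a).
Local Notation q1 := (normal_q1 a h).
Local Notation q2 := (normal_q2 a h).
Local Notation q3 := (normal_q3 a h).
Local Notation V := (abel_system q0 q1 q2 q3).
Local Notation r := (q0^:P + q1^:P * 'Y).

(** Taking [b = q0] and [c = q1], the coefficients of [1] and [y] cancel at once; the other two are
    identities in [x], [a], [h] and the derivatives of [h]. *)
Lemma abel_commutant_normal : abel_commutant V r = 0.
Proof.
have dq0 : q0^`() = 1 + 3 * (a ^+ 2)%:P * 'X^2.
  by rewrite derivD derivX derivM derivC derivXn; ring.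
have ddq0 : q0^`()^`() = 6 * (a ^+ 2)%:P * 'X.
  by rewrite dq0 -polyC_natr !poly.derivCE polyC_natr /=; ring.
have dq1 : q1^`() = a%:P + q0^`() * h + q0 * h^`().
  rewrite /normal_q1; move: (normal_q0 a) => p.
  by rewrite derivD !derivM derivX derivC; ring.
have ddq1 : q1^`()^`() = q0^`()^`() * h + 2 * q0^`() * h^`() + q0 * h^`()^`().
  rewrite dq1; move: (normal_q0 a) => p.
  by rewrite !derivD !derivM derivC; ring.
have dq2 : q2^`() = 3 * q0^`() * h ^+ 2 + 6 * q0 * h * h^`() + 6 * a%:P * (h + 'X * h^`()).
  rewrite /normal_q2; move: (normal_q0 a) => p.
  by rewrite -!polyC_natr !poly.derivCE !polyC_natr /=; ring.
have dq3 : q3^`() = q0^`() * h ^+ 3 + 3 * q0 * h ^+ 2 * h^`() + 3 * a%:P * h ^+ 2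
    + 6 * a%:P * 'X * h * h^`() - h^`()^`().
  rewrite /normal_q3; move: (normal_q0 a) => p.
  by rewrite -!polyC_natr !poly.derivCE !polyC_natr /=; ring.
rewrite abel_commutant_linear.
have -> : q0 * q0^`() - q0 * q0^`() = 0 by ring.
have -> : 3 * (q0 * q1^`() - q1^`() * q0) = 0 by ring.
have -> : q0^`()^`() - 6 * q1^`() * q1 + q2 * q0^`() + q0 * q2^`() = 0.
  by rewrite ddq0 dq1 dq2 dq0 /normal_q1 /normal_q2 /normal_q0 polyC_exp; ring.
have -> : q1^`()^`() - q1^`() * q2 + 2 * q0^`() * q3 + q0 * q3^`() = 0.
  by rewrite ddq1 ddq0 dq1 dq3 dq0 /normal_q2 /normal_q3 /normal_q0 polyC_exp; ring.
by rewrite rmorph0 !mul0r !addr0.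
Qed.

Lemma normal_q2E : q0^`() + q0 * q2 = 1 + 3 * q1 ^+ 2.
Proof.
rewrite /normal_q2 /normal_q1 derivD derivX derivM derivC derivXn.
by rewrite /normal_q0 polyC_exp; ring.
Qed.

End NormalForm.

Theorem theorem8 (R : realType) (q0 q1 q2 q3 : {poly R})
    (q0_0 : q0.[0] = 0) (dq0_0 : q0^`().[0] = 1)
    (q1_0 : q1.[0] = 0) (q3_neq0 : q3 <> 0) :
  (exists W : planar_field R,
     commuting (abel_system q0 q1 q2 q3) W
     /\ transversal_near_origin (abel_system q0 q1 q2 q3) W)
  <->
  (exists (a : R) (h : {poly R}),
     abel_system q0 q1 q2 q3 = abel_normal_form a h).
Proof.
split=> [[W [comm tr]] | [a [h ->]]].
  have [q2E q3E] := abel_commuting_necessary q0_0 dq0_0 q1_0 q3_neq0 comm tr.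
  have [a [h [q0h q1h q2h q3h]]] := abel_coefficients q0_0 q1_0 dq0_0 q2E q3E.
  exists a, h; rewrite abel_normal_formE /normal_q3 /normal_q2 /normal_q1.
  by rewrite /normal_q0 -q0h -q1h -q2h -q3h.
rewrite abel_normal_formE; set V := abel_system _ _ _ _.
pose r := (normal_q0 a)^:P + (normal_q1 a h)^:P * 'Y.
exists (r, - lie_derivative V r); split.
  by apply/commuting_YP; split => //; exact: abel_commutant_normal.
apply: abel_transversal; first exact: normal_q2E.
move=> x; rewrite /root /normal_q0 hornerD hornerM hornerC hornerX hornerXn.
(* The factor [1 + (a x)^2] is positive, so 0 is the only real root. *)
have -> : x + a ^+ 2 * x ^+ 3 = x * (1 + (a * x) ^+ 2) by ring.
by rewrite mulf_eq0 (gt_eqF (ltr_wpDr (sqr_ge0 _) ltr01)) orbF => /eqP.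
Qed.
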